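(* Let $L>0$ and let $\psi_\vartheta:\mathbb{R}^n\to\mathbb{R}$ be convex and $L$-smooth. Then, for every $\alpha$ with $0<\alpha\le \frac{1}{L}$, the operator $D_{\vartheta,\alpha}:\mathbb{R}^n\to\mathbb{R}^n$ defined by $$D_{\vartheta,\alpha}(\mathbf{x})=\mathbf{x}-\alpha\nabla\psi_\vartheta(\mathbf{x})$$ is firmly nonexpansive.
   Context: $\mathbb{R}^n$ carries the Euclidean inner product $\langle\cdot,\cdot\rangle$ and norm $\|\cdot\|_2$. A function is $L$-smooth if it is differentiable with $L$-Lipschitz continuous gradient. An operator $T:\mathcal{H}\to\mathcal{H}$ on a Hilbert space $\mathcal{H}$ is firmly nonexpansive if $\|T(x)-T(y)\|_2^2\le\langle x-y,\,T(x)-T(y)\rangle$ for every $x,y\in\mathcal{H}$. The subscript $\vartheta$ only denotes the parameters of the (fixed) function $\psi_\vartheta$. *)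

(* Defs.v *)
From HB Require Import structures.
From mathcomp Require Import all_boot all_order all_algebra.
From mathcomp Require Import all_classical all_reals all_analysis.

Set Implicit Arguments.
Unset Strict Implicit.
Unset Printing Implicit Defensive.

Import Order.TTheory GRing.Theory Num.Theory.
Import numFieldNormedType.Exports.

Local Open Scope classical_set_scope.
Local Open Scope ring_scope.

Section Euclidean.
Context {R : realType} {n : nat}.

Definition inner (x y : 'rV[R]_n) : R := \sum_(i < n) x 0 i * y 0 i.

(* The library norm `|x| on 'rV[R]_n is the sup norm, hence a separate
   Euclidean norm; both induce the same topology, so the library notions of
   differentiability and derivative apply unchanged. *)
Definition norm2 (x : 'rV[R]_n) : R := Num.sqrt (inner x x).

Definition gradient (f : 'rV[R]_n -> R^o) (x : 'rV[R]_n) : 'rV[R]_n :=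
  \row_(i < n) 'D_(delta_mx 0 i) f x.

Definition smooth (L : R) (f : 'rV[R]_n -> R^o) : Prop :=
  (forall x, differentiable f x) /\
  (forall x y, norm2 (gradient f x - gradient f y) <= L * norm2 (x - y)).

Definition firmly_nonexpansive (T : 'rV[R]_n -> 'rV[R]_n) : Prop :=
  forall x y, norm2 (T x - T y) ^+ 2 <= inner (x - y) (T x - T y).

Definition gradient_step (f : 'rV[R]_n -> R^o) (alpha : R) (x : 'rV[R]_n) :
    'rV[R]_n :=
  x - alpha *: gradient f x.

End Euclidean.

(* Main.v *)
Require Import Defs.
From mathcomp Require Import all_boot all_order all_algebra.
From mathcomp Require Import all_classical all_reals all_analysis.
From mathcomp Require Import ring lra.
Import Order.TTheory GRing.Theory Num.Theory.
Import numFieldNormedType.Exports.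
Local Open Scope classical_set_scope.
Local Open Scope ring_scope.

(** This is the Baillon-Haddad argument. Convexity puts the graph of [f] above
    its tangent planes, and smoothness puts it below the tangent paraboloids of
    curvature [L]. Comparing the tangent plane at [x] and the tangent paraboloid
    at [y] in the point [y - (grad f y - grad f x) / L], which minimizes their
    difference, strengthens the tangent inequality by
    [|grad f y - grad f x|^2 / (2 L)]. Adding the strengthened inequalities for
    [(x, y)] and [(y, x)] gives cocoercivity of the gradient with constant
    [1 / L], and hence with constant [alpha], which is firm nonexpansiveness of
    the gradient step after expanding the inner products. *)

Section InnerProduct.
Context {R : realType} {n : nat}.
Implicit Types x y z : 'rV[R]_n.

Lemma innerC x y : inner x y = inner y x.
Proof. by apply: eq_bigr => i _; rewrite mulrC. Qed.

Lemma innerDl x y z : inner (x + y) z = inner x z + inner y z.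
Proof. by rewrite -big_split; apply: eq_bigr => i _; rewrite mxE mulrDl. Qed.

Lemma innerZl (a : R) x y : inner (a *: x) y = a * inner x y.
Proof. by rewrite mulr_sumr; apply: eq_bigr => i _; rewrite mxE mulrA. Qed.

Lemma innerNl x y : inner (- x) y = - inner x y.
Proof. by rewrite -scaleN1r innerZl mulN1r. Qed.

Lemma innerDr x y z : inner x (y + z) = inner x y + inner x z.
Proof. by rewrite innerC innerDl !(innerC x). Qed.

Lemma innerZr (a : R) x y : inner x (a *: y) = a * inner x y.
Proof. by rewrite innerC innerZl innerC. Qed.

Lemma innerNr x y : inner x (- y) = - inner x y.
Proof. by rewrite innerC innerNl innerC. Qed.

Definition inner_linear :=
  (innerDl, innerDr, innerNl, innerNr, innerZl, innerZr).

Lemma inner_ge0 x : 0 <= inner x x.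
Proof. by apply: sumr_ge0 => i _; rewrite -expr2 sqr_ge0. Qed.

Lemma sqr_norm2 x : norm2 x ^+ 2 = inner x x.
Proof. by rewrite sqr_sqrtr// inner_ge0. Qed.

Lemma norm2Z (a : R) x : norm2 (a *: x) = `|a| * norm2 x.
Proof.
by rewrite /norm2 innerZl innerZr mulrA -expr2 sqrtrM ?sqr_ge0// sqrtr_sqr.
Qed.

(** Expanding [0 <= |x - c y|^2] gives [2 c <x, y> <= |x|^2 + c^2 |y|^2 <= 2 c^2 |y|^2]; dividing by
    [2 c] needs [c > 0]. This stands in for Cauchy-Schwarz. *)
Lemma inner_le_of_norm2_le (c : R) x y :
  0 < c -> norm2 x <= c * norm2 y -> inner x y <= c * inner y y.
Proof.
move=> c0 xy.
have: norm2 x ^+ 2 <= (c * norm2 y) ^+ 2.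
  by rewrite lerXn2r// nnegrE ?sqrtr_ge0// mulr_ge0 ?sqrtr_ge0// ltW.
rewrite exprMn !sqr_norm2 => xxyy.
have := inner_ge0 (x - c *: y); rewrite !inner_linear (innerC y x) => xy0.
rewrite -(ler_pM2l c0); lra.
Qed.

End InnerProduct.

Section Gradient.
Context {R : realType} {n : nat}.
Implicit Types (f : 'rV[R]_n -> R^o) (x y h : 'rV[R]_n).

Lemma derive_gradient f x h :
  differentiable f x -> 'D_h f x = inner (gradient f x) h.
Proof.
move=> df; rewrite deriveE// [in LHS](row_sum_delta h) linear_sum.
by apply: eq_bigr => i _; rewrite mxE linearZ deriveE// mulrC.
Qed.

(** The difference quotients of the restriction to the line are those of [f] at [t *: h + x] in
    direction [h]. *)
Lemma is_derive_line f x h (t : R) : differentiable f (t *: h + x) ->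
  is_derive t 1 (fun s : R => f (s *: h + x) : R)
    (inner (gradient f (t *: h + x)) h).
Proof.
move=> df; have /derivableP [dh Dh] := @diff_derivable _ _ _ _ _ h df.
have E : (fun r : R => r^-1 *: (((fun s : R => f (s *: h + x) : R) \o shift t)
      (r *: (1 : R)) - f (t *: h + x))) =
    (fun r : R => r^-1 *: ((f \o shift (t *: h + x)) (r *: h)
      - f (t *: h + x))).
  by apply: funext => r /=; rewrite [r%:A]mulr1 scalerDl addrA.
split; first by rewrite /derivable E.
by rewrite /derive E -derive_gradient.
Qed.

(** By convexity, the difference quotients at [x] towards [y] with step [t] in [(0, 1)] are at most
    [f y - f x]; let [t] tend to 0 from the right. *)
Lemma convex_tangent_le f x y :
  @convex_function R 'rV[R]_n setT f -> differentiable f x ->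
  f x + inner (gradient f x) (y - x) <= f y.
Proof.
move=> cf df; rewrite -derive_gradient// addrC -lerBrDr.
have /cvg_dnbhs_at_right dq := @diff_derivable _ _ _ _ _ (y - x) df.
apply: (cvgr_to_le dq); near=> t.
have t0 : 0 < t by near: t; exact: nbhs_right_gt.
have t1 : t < 1 by near: t; exact: nbhs_right_lt.
have t01 : Itv.spec (@Itv.num_sem R) (Itv.Real `[0%Z, 1%Z]) t.
  by rewrite /= /Itv.num_sem /= num_real in_itv /= !ltW.
have := cf (Itv.mk t01) y x (mem_setT _) (mem_setT _).
rewrite convRE /conv /= /unstable.onem => ft.
rewrite [_ *: _]mulrC ler_pdivrMr//.
have -> : t *: (y - x) + x = t *: y + (1 - t) *: x.
  by rewrite scalerBr scalerBl scale1r addrAC addrA.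
lra.
Unshelve. all: by end_near. Qed.

Lemma smooth_le_paraboloid (L : R) f x y : 0 < L -> smooth L f ->
  f y <= f x + inner (gradient f x) (y - x) + L / 2 * inner (y - x) (y - x).
Proof.
move=> L0 [df lipf]; set h := y - x.
set c := inner (gradient f x) h; set q := inner h h.
(* The claim is [F 1 <= F 0], so by the mean value theorem it suffices that the derivative of [F] is
   nonpositive inside [[0, 1]]. *)
pose p : {poly R} := c *: 'X + (L / 2 * q) *: 'X^2.
pose F : R -> R := (fun t : R => f (t *: h + x) : R) - horner p.
have dF (t : R) : is_derive t (1 : R) F
    (inner (gradient f (t *: h + x)) h - p^`().[t]).
  apply: is_deriveB; exact: is_derive_line.
have cF : {within `[0, 1], continuous F}.
  apply: continuous_subspaceT => t.
  exact/differentiable_continuous/derivable1_diffP.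
have [t] := MVT ltr01 (fun t _ => dF t) cF.
rewrite in_itv /= => /andP[t0 _].
have -> : p^`().[t] = c + L * t * q.
  by rewrite /p !poly.derivE !hornerE; field.
rewrite /F !fctE /p !hornerE /= scale0r scale1r add0r subrK => E.
(* The two base points differ by [t *: h], and [L * t > 0] because the mean value point is
   interior. *)
have : inner (gradient f (t *: h + x) - gradient f x) h <= L * t * q.
  apply: inner_le_of_norm2_le; first exact: mulr_gt0.
  apply: le_trans (lipf _ _) _; rewrite addrK.
  by rewrite norm2Z gtr0_norm// mulrA.
rewrite innerDl innerNl -/c; lra.
Qed.

Lemma bregman_ge (L : R) f x y : 0 < L ->
  @convex_function R 'rV[R]_n setT f -> smooth L f ->
  f x + inner (gradient f x) (y - x)
    + inner (gradient f y - gradient f x) (gradient f y - gradient f x) / (2 * L)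
  <= f y.
Proof.
move=> L0 cf sf; set g := gradient f y - gradient f x.
have := convex_tangent_le _ x (y - L^-1 *: g) cf (sf.1 x).
have := smooth_le_paraboloid L f y (y - L^-1 *: g) L0 sf.
rewrite [y - _ - y]addrAC subrr add0r [y - _ - x]addrAC.
have -> : gradient f y = gradient f x + g by rewrite addrC subrK.
move: g (y - x) => g d; rewrite !inner_linear => ub lb.
(* All multiples of [inner g g] are expressed through [inner g g / (2 * L)], which makes the goal
   linear. *)
have E : L / 2 * (L^-1 * (L^-1 * inner g g)) = inner g g / (2 * L).
  by field; rewrite gt_eqF.
have E' : L^-1 * inner g g = 2 * (inner g g / (2 * L)).
  by field; rewrite gt_eqF.
lra.
Qed.

Lemma gradient_cocoercive (L : R) f x y : 0 < L ->
  @convex_function R 'rV[R]_n setT f -> smooth L f ->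
  inner (gradient f x - gradient f y) (gradient f x - gradient f y) / L
  <= inner (x - y) (gradient f x - gradient f y).
Proof.
move=> L0 cf sf.
have := bregman_ge L f x y L0 cf sf; have := bregman_ge L f y x L0 cf sf.
rewrite -(opprB (gradient f x) (gradient f y)) -(opprB x y).
set g := gradient f x - gradient f y.
have -> : gradient f x = gradient f y + g by rewrite addrC subrK.
move: g (x - y) => g d.
rewrite !inner_linear (innerC d g).
have : inner g g / L = 2 * (inner g g / (2 * L)) by field; rewrite gt_eqF.
lra.
Qed.

End Gradient.

Theorem lemma2p3 (R : realType) (n : nat) (L : R) (psi : 'rV[R]_n -> R^o)
  (L_gt0 : 0 < L)
  (psi_convex : @convex_function R 'rV[R]_n setT psi)
  (psi_smooth : smooth L psi) :
  forall alpha : R, 0 < alpha -> alpha <= 1 / L ->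
    firmly_nonexpansive (gradient_step psi alpha).
Proof.
move=> alpha alpha0 alphaL x y; rewrite sqr_norm2 /gradient_step.
have -> : x - alpha *: gradient psi x - (y - alpha *: gradient psi y)
    = (x - y) - alpha *: (gradient psi x - gradient psi y).
  by rewrite scalerBr !opprB addrACA [- _ - _]addrC addrACA.
have := gradient_cocoercive L psi x y L_gt0 psi_convex psi_smooth.
move: (gradient psi x - gradient psi y) (x - y) => g d coco.
have ag : alpha * inner g g <= inner d g.
  apply: le_trans coco; rewrite mulrC ler_wpM2l ?inner_ge0// -div1r//.
rewrite !inner_linear (innerC g d).
(* After cancelling [inner d d] and one [alpha * inner d g], this is exactly what the goal asks. *)
have : alpha * (alpha * inner g g) <= alpha * inner d g by rewrite ler_pM2l.
lra.
Qed.
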